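(* There exists some constant $K>0$ such that the following holds. Let $q=q(n)$ be positive integers with $q\ge n^{2+K\log^{-1/2}n}$ and let $\chi$ be a random $q$-colouring of the hypercube $Q_n$. Then with high probability, $\chi$ is $1$-distinguishable.
   Context: $Q_n$ is the $n$-dimensional hypercube: vertex set $\{0,1\}^n$, two vertices adjacent iff they differ in exactly one coordinate. A random $q$-colouring of $Q_n$ is an independent family $(\chi(v))_{v\in V(Q_n)}$ of random variables, each uniform on $\{1,\dots,q\}$. ''With high probability'' means with probability tending to $1$ as $n\to\infty$. $\log^{-1/2}n$ means $(\log n)^{-1/2}$. For a vertex $v$, $B_r(v)$ is the subgraph induced by the vertices at graph distance at most $r$ from $v$, and $\chi^{(r)}(v)=\chi|_{B_r(v)}$. Colourings $\chi$ of a graph $G$ and $\lambda$ of a graph $H$ are equivalent, $\chi\cong\lambda$, if there is a graph isomorphism $\phi:G\to H$ with $\chi=\lambda\circ\phi$. Colourings $\chi,\lambda$ of $V(Q_n)$ are $r$-locally equivalent, $\chi\cong_r\lambda$, if there is a bijection $f:V(Q_n)\to V(Q_n)$ with $\chi^{(r)}(v)\cong\lambda^{(r)}(f(v))$ for all $v$. A colouring $\chi$ is $r$-distinguishable if there is no colouring $\lambda$ of $V(Q_n)$ with $\chi\cong_r\lambda$ but $\chi\not\cong\lambda$. *)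

(* Defs.v *)
From HB Require Import structures.
From mathcomp Require Import all_boot all_order all_algebra.
From mathcomp Require Import all_classical all_reals all_analysis.

Set Implicit Arguments.
Unset Strict Implicit.
Unset Printing Implicit Defensive.

Import Order.TTheory GRing.Theory Num.Theory.
Import numFieldNormedType.Exports.

Local Open Scope classical_set_scope.
Local Open Scope ring_scope.

Record graph := Graph {
  vertex :> finType;
  adj : rel vertex;
  adj_sym : symmetric adj;
  adj_irr : irreflexive adj
}.

Lemma induced_sym (G : graph) (A : {set G}) :
  symmetric (fun x y : {x : G | x \in A} => adj (val x) (val y)).
Proof. by move=> x y; rewrite adj_sym. Qed.

Lemma induced_irr (G : graph) (A : {set G}) :
  irreflexive (fun x y : {x : G | x \in A} => adj (val x) (val y)).
Proof. by move=> x; rewrite adj_irr. Qed.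

Definition induced (G : graph) (A : {set G}) : graph :=
  Graph (@induced_sym G A) (@induced_irr G A).

(* There is a walk of length at most r from x to y. *)
Definition dist_le (G : graph) (r : nat) (x y : G) : bool :=
  [exists k : 'I_r.+1, [exists p : k.-tuple G,
    path (@adj G) x p && (last x p == y)]].

Definition ball_set (G : graph) (r : nat) (v : G) : {set G} :=
  [set w | dist_le r v w]%SET.

Definition ball_graph (G : graph) (r : nat) (v : G) : graph :=
  induced (ball_set r v).

(* Palettes {1, ..., q} are subsets of nat; a competing colouring is allowed to
   use any colours. *)
Definition colouring (G : graph) := G -> nat.

Definition local_colouring (G : graph) (r : nat) (chi : colouring G) (v : G) :
    colouring (ball_graph r v) :=
  fun x => chi (val x).
Arguments local_colouring {G} r chi v.

Definition graph_iso (G H : graph) (phi : G -> H) : Prop :=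
  bijective phi /\ forall x y : G, adj (phi x) (phi y) = adj x y.

Definition col_equiv (G H : graph) (chi : colouring G) (lam : colouring H) :
    Prop :=
  exists phi : G -> H, graph_iso phi /\ forall x : G, chi x = lam (phi x).

Definition locally_equiv (G : graph) (r : nat) (chi lam : colouring G) : Prop :=
  exists f : G -> G, bijective f /\
    forall v : G, col_equiv (local_colouring r chi v)
                            (local_colouring r lam (f v)).

Definition distinguishable (G : graph) (r : nat) (chi : colouring G) : Prop :=
  ~ exists lam : colouring G, locally_equiv r chi lam /\ ~ col_equiv chi lam.

Definition cube_adj (n : nat) : rel {ffun 'I_n -> bool} :=
  fun x y => #|[set i | x i != y i]%SET| == 1%N.

Lemma cube_adj_sym n : symmetric (@cube_adj n).
Proof.
move=> x y; rewrite /cube_adj; congr (_ == _).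
by apply: eq_card => i; rewrite !inE eq_sym.
Qed.

Lemma cube_adj_irr n : irreflexive (@cube_adj n).
Proof.
move=> x; rewrite /cube_adj (_ : [set i | x i != x i]%SET = finset.set0) ?cards0//.
by apply/setP => i; rewrite !inE eqxx.
Qed.

Definition hypercube (n : nat) : graph :=
  Graph (@cube_adj_sym n) (@cube_adj_irr n).

Definition mutually_independent (R : realType) (d d' : measure_display)
    (T : measurableType d) (T' : measurableType d') (P : probability T R)
    (I : finType) (X : I -> {RV P >-> T'}) : Prop :=
  forall (J : {set I}) (A : I -> set T'), (forall i, measurable (A i)) ->
    P (\bigcap_(i in [set` J]) (X i @^-1` A i)) =
    (\prod_(i in J) P (X i @^-1` A i))%E.

Definition uniform_colour (R : realType) (d : measure_display)
    (T : measurableType d) (P : probability T R) (q : nat)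
    (X : {RV P >-> nat}) : Prop :=
  forall c : nat,
    distribution P X [set c] = (if (0 < c <= q)%N then q%:R^-1 else 0)%:E.

Definition random_colouring (R : realType) (d : measure_display)
    (T : measurableType d) (P : probability T R) (G : graph) (q : nat)
    (chi : G -> {RV P >-> nat}) : Prop :=
  (forall v : G, uniform_colour q (chi v)) /\ mutually_independent chi.

(* Main.v *)
Require Import Defs.
From HB Require Import structures.
From mathcomp Require Import all_boot all_order all_algebra.
From mathcomp Require Import zify.

Set Implicit Arguments.
Unset Strict Implicit.
Unset Printing Implicit Defensive.

(* Let f witness chi ~_1 lam and write N(v) for the neighbourhood of v and
   N_f(v) for the preimage under f of the neighbourhood of f v.  For every v,
   N_f(v) and N(v) have the same multiset of chi-colours; we show that whp this
   forces N_f = N, so f is itself an isomorphism of coloured graphs.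

   Fix disjoint R, Z with |Z| <= n^2.  Every vertex of R has a colour appearing
   in Z with probability at most (n^2/q)^|R|, so if q >= L n^2 with L a large
   constant, union bounds exclude (a) all R in N(S), Z = N(S) \ R with |S| = n
   and |R| >= n^2/10, and (b) all R in N(u), Z = N(v) or Z = N(N(v)) with
   |R| >= n/40.  The hypothesis on q gives q >= L n^2 for every L eventually.

   Given (a) and (b):
   1. The colours on N(N_f(v)) all occur on N_f(N_f(v)), a set of size about
      n^2/2, so by (a) |N(N_f(v))| <= 0.6 n^2.  This forces some u to have at
      least n/30 neighbours in N_f(v).
   2. These neighbours have colours from N(v), so u = v by (b).
   3. If w is in N_f(v) but not in N(v), close each v' in N_f(v) /\ N(v) to a
      4-cycle v', v, w, w' for the pulled-back adjacency.  The colour of w'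
      occurs in N(v'), hence in N(N(v)), and also in N(w); this contradicts
      (b). *)

(** * Geometry of the cube *)

Section Cube.
Variable n : nat.
Local Notation V := {ffun 'I_n -> bool}.
Implicit Types (x y z u v w : V) (A B D : {set 'I_n}) (S R : {set V}).

Definition diffs x y : {set 'I_n} := [set i | x i != y i].
Definition flip x A : V := [ffun i => x i (+) (i \in A)].
Definition symd A B : {set 'I_n} := [set i | (i \in A) (+) (i \in B)].
Definition nbr x : {set V} := [set y | cube_adj x y].
Definition nbrs S : {set V} := \bigcup_(x in S) nbr x.

Lemma diffs_flip x A : diffs x (flip x A) = A.
Proof. by apply/setP => i; rewrite !inE ffunE; case: (x i); case: (i \in A). Qed.

Lemma flip_diffs x y : flip x (diffs x y) = y.
Proof. by apply/ffunP => i; rewrite ffunE inE; case: (x i); case: (y i). Qed.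

Lemma diffsC x y : diffs x y = diffs y x.
Proof. by apply/setP => i; rewrite !inE eq_sym. Qed.

Lemma diffs_symd x y z : diffs y z = symd (diffs x y) (diffs x z).
Proof. by apply/setP => i; rewrite !inE; case: (x i); case: (y i); case: (z i). Qed.

Lemma card_symd A B : #|symd A B| + 2 * #|A :&: B| = #|A| + #|B|.
Proof.
rewrite -[#|A|](cardsID B) -[#|B|](cardsID A) (setIC B A).
have -> : symd A B = (A :\: B) :|: (B :\: A).
  by apply/setP => i; rewrite !inE; case: (i \in A); case: (i \in B).
rewrite cardsU (_ : _ :&: _ = set0) ?cards0; first lia.
by apply/setP => i; rewrite !inE; case: (i \in A); case: (i \in B).
Qed.

Lemma diffs_eq0 x y : (#|diffs x y| == 0) = (x == y).
Proof.
rewrite cards_eq0; apply/eqP/eqP => [d0|->]; last by apply/setP => i; rewrite !inE eqxx.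
by rewrite -(flip_diffs x y) d0; apply/ffunP => i; rewrite ffunE inE addbF.
Qed.

Lemma nbrP x y : reflect (exists i, y = flip x [set i]) (y \in nbr x).
Proof.
rewrite inE; apply: (iffP cards1P) => [[i di]|[i ->]]; exists i; last exact: diffs_flip.
by rewrite -di flip_diffs.
Qed.

Lemma mem_nbr x y : (y \in nbr x) = (#|diffs x y| == 1).
Proof. by rewrite inE. Qed.

Lemma nbr_sym x y : (y \in nbr x) = (x \in nbr y).
Proof. by rewrite !mem_nbr diffsC. Qed.

Lemma flip_inj x : injective (flip x).
Proof. by move=> A B /(congr1 (diffs x)); rewrite !diffs_flip. Qed.

Lemma card_nbr x : #|nbr x| = n.
Proof.
have -> : nbr x = [set flip x [set i] | i : 'I_n].
  apply/setP => y; apply/nbrP/imsetP => [[i ->]|[i _ ->]]; by exists i.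
rewrite card_imset ?card_ord // => i j /flip_inj /setP/(_ i).
by rewrite !inE eqxx => /esym/eqP.
Qed.

Lemma exists_nbr_neq x y : 2 <= n -> exists2 z, z \in nbr x & z != y.
Proof.
move=> n2; have /card_gt0P[z] : 0 < #|nbr x :\ y|.
  have := leq_trans n2 (eq_leq (esym (card_nbr x))).
  by rewrite (cardsD1 y); case: (y \in _) => //; apply: ltnW.
by case/setD1P => zy zx; exists z.
Qed.

Lemma nbrsP S y : reflect (exists2 x, x \in S & y \in nbr x) (y \in nbrs S).
Proof. exact: bigcupP. Qed.

Lemma card_nbrs_le S : #|nbrs S| <= #|S| * n.
Proof.
rewrite -sum_nat_const /nbrs.
elim/big_rec2: _ => [|x k A _ le_Ak]; first by rewrite cards0.
by apply: leq_trans (leq_card_setU _ _) _; rewrite card_nbr leq_add2l.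
Qed.

Lemma nbrs_nbr_diffs x y : y \in nbrs (nbr x) ->
  #|diffs x y| = 0 \/ #|diffs x y| = 2.
Proof.
case/nbrsP => z; rewrite !mem_nbr => /eqP xz /eqP zy.
have := card_symd (diffs z x) (diffs z y); rewrite -diffs_symd (diffsC z x) xz zy; lia.
Qed.

Lemma card_nbrs_nbr x : 2 <= n -> 2 * #|nbrs (nbr x)| <= n ^ 2.
Proof.
move=> n2; pose P := [set A : {set 'I_n} | #|A| == 2].
have cP : #|P| = 'C(n, 2) by rewrite -[in RHS](card_ord n) card_draws.
have : nbrs (nbr x) \subset flip x @: (set0 |: P).
  apply/subsetP => y /nbrs_nbr_diffs yx; apply/imsetP; exists (diffs x y).
    by rewrite !inE -cards_eq0; case: yx => ->.
  by rewrite flip_diffs.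
move/subset_leq_card/leq_trans/(_ (leq_imset_card _ _)).
rewrite cardsU1 cP bin2 => le1.
have := odd_double_half (n * n.-1); rewrite -mul2n.
move: le1; case: (_ \notin _) => /=; nia.
Qed.

Lemma nbr_triangle_free x y z : y \in nbr x -> z \in nbr x -> z \notin nbr y.
Proof.
rewrite !mem_nbr => /eqP xy /eqP xz.
have := card_symd (diffs x y) (diffs x z); rewrite -diffs_symd xy xz; lia.
Qed.

(** A common neighbour of distinct vertices forces distance 2 and arises from [x] by flipping one of
    the two differing coordinates. The boolean factor lets the bound be summed over pairs. *)
Lemma card_common_nbr x y : x != y ->
  #|nbr x :&: nbr y| <= 2 * (#|diffs x y| == 2).
Proof.
rewrite -diffs_eq0 => xy.
have common i : flip x [set i] \in nbr y -> #|diffs x y| = 2 /\ i \in diffs x y.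
  rewrite mem_nbr => /eqP yi.
  have := card_symd (diffs x y) [set i].
  rewrite -{1}(diffs_flip x [set i]) -diffs_symd yi cards1.
  have : #|diffs x y :&: [set i]| <= 1.
    by rewrite -(cards1 i) subset_leq_card // subsetIr.
  move=> le1 cd; have c1 : #|diffs x y :&: [set i]| = 1 by lia.
  split; first lia.
  have /card_gt0P[j] : 0 < #|diffs x y :&: [set i]| by rewrite c1.
  by rewrite inE in_set1 => /andP[dj /eqP <-].
case: (posnP #|nbr x :&: nbr y|) => [->//|/card_gt0P[z]].
rewrite inE => /andP[/nbrP[i ->]] /common[d2 _]; rewrite d2 eqxx muln1 -d2.
rewrite -(card_imset (mem (diffs x y)) (_ : injective (fun i => flip x [set i]))).
  apply/subset_leq_card/subsetP => w; rewrite inE => /andP[/nbrP[j ->]] /common[_ dj].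
  exact: imset_f.
by move=> j k /flip_inj/setP/(_ j); rewrite !inE eqxx => /esym/eqP.
Qed.

(** Since [w] is at distance at least 2 from [v], a neighbour of [w] at distance 0 or 2 from [v]
    lies one step closer to [v]. So [w] is at distance 3, and only three flips are possible. *)
Lemma card_nbr_nbrs_nbr v w : v != w -> w \notin nbr v ->
  #|nbr w :&: nbrs (nbr v)| <= 3.
Proof.
rewrite -diffs_eq0 mem_nbr => vw0 vw1.
have step i : flip w [set i] \in nbrs (nbr v) ->
    i \in diffs w v /\ #|diffs w v| <= 3.
  move/nbrs_nbr_diffs; rewrite (diffs_symd w) diffs_flip => vi.
  have := card_symd (diffs w v) [set i]; rewrite cards1.
  case: (boolP (i \in diffs w v)) => iw.
    rewrite (setIidPr _) ?sub1set // cards1; split=> //; lia.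
  rewrite (_ : _ :&: _ = set0) ?cards0.
    by move: vw0 vw1; rewrite (diffsC v w); lia.
  apply/setP => j; rewrite !inE; case: (j =P i) => [->|]; last by rewrite andbF.
  by move: iw; rewrite inE andbT => /negbTE.
case: (posnP #|nbr w :&: nbrs (nbr v)|) => [->//|/card_gt0P[z]].
rewrite inE => /andP[/nbrP[i ->]] /step[_ d3]; apply: leq_trans d3.
apply: leq_trans (leq_imset_card (fun i => flip w [set i]) _).
apply/subset_leq_card/subsetP => y; rewrite inE => /andP[/nbrP[j ->]] /step[dj _].
exact: imset_f.
Qed.

(** If some [z] is counted, the only distance left for [x] and [y] is 4; then [diffs x z] is one of
    the 2^4 subsets of [diffs x y]. *)
Lemma card_dist2_common x y : #|diffs x y| != 0 -> #|diffs x y| != 2 ->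
  #|[set z | (#|diffs z x| == 2) && (#|diffs z y| == 2)]| <= 16.
Proof.
move=> d0 d2.
have step z : #|diffs z x| = 2 -> #|diffs z y| = 2 ->
    diffs x z \subset diffs x y /\ #|diffs x y| = 4.
  rewrite (diffsC z x) => xz yz.
  have := card_symd (diffs x z) (diffs x y); rewrite -diffs_symd xz yz => cd.
  have le2 : #|diffs x z :&: diffs x y| <= 2 by rewrite -xz subset_leq_card // subsetIl.
  have e4 : #|diffs x y| = 4 by lia.
  split=> //; apply/setIidPl/eqP; rewrite eqEcard subsetIl xz.
  by have -> : #|diffs x z :&: diffs x y| = 2 by lia.
set Q := [set _ | _]; case: (posnP #|Q|) => [->//|/card_gt0P[z]].
rewrite inE => /andP[/eqP zx /eqP zy]; have [_ e4] := step _ zx zy.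
rewrite -[16]/(2 ^ 4) -{1}e4 -card_powerset.
apply: leq_trans (leq_imset_card (flip x) _).
apply/subset_leq_card/subsetP => t; rewrite inE => /andP[/eqP tx /eqP ty].
apply/imsetP; exists (diffs x t); last by rewrite flip_diffs.
by rewrite inE; have [] := step _ tx ty.
Qed.

(** Two 2-sets whose symmetric difference has size 2 share exactly one coordinate [a]; flipping [a]
    in [x] gives the centre. *)
Lemma dist2_triangle x y z : #|diffs x y| = 2 -> #|diffs x z| = 2 ->
  #|diffs y z| = 2 -> exists u, [/\ x \in nbr u, y \in nbr u & z \in nbr u].
Proof.
move=> xy xz; rewrite (diffs_symd x) => yz.
have := card_symd (diffs x y) (diffs x z); rewrite xy xz yz => ci.
have /cards1P[a ea] : #|diffs x y :&: diffs x z| == 1 by apply/eqP; lia.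
have toa t : #|diffs x t| = 2 -> a \in diffs x t -> t \in nbr (flip x [set a]).
  move=> xt at_; rewrite mem_nbr (diffs_symd x) diffs_flip.
  have := card_symd [set a] (diffs x t).
  rewrite (setIidPl _) ?sub1set // cards1 xt; lia.
have [ay az] : a \in diffs x y /\ a \in diffs x z.
  by apply/setIP; rewrite ea set11.
exists (flip x [set a]); split; [|exact: toa..].
by rewrite mem_nbr diffsC diffs_flip cards1.
Qed.
End Cube.

(** * Sets of n vertices with small neighbourhood *)

Section Cluster.
Variable n : nat.
Local Notation V := {ffun 'I_n -> bool}.
Implicit Types (x y z u v w : V) (A B D : {set 'I_n}) (S R : {set V}).

Let dist2 x y : bool := #|diffs x y| == 2.

Lemma card_setIE (T : finType) (A B : {set T}) : #|A :&: B| = \sum_(x in A) (x \in B).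
Proof.
rewrite -sum1_card big_mkcond [RHS]big_mkcond; apply: eq_bigr => x _.
by rewrite inE; case: (x \in A); case: (x \in B).
Qed.

Lemma sum_deg S : \sum_u #|S :&: nbr u| = #|S| * n.
Proof.
under eq_bigr do rewrite card_setIE.
rewrite exchange_big -sum_nat_const; apply: eq_bigr => w _.
under eq_bigr do rewrite nbr_sym.
rewrite -[RHS](card_nbr w) -sum1_card [RHS]big_mkcond.
by apply: eq_bigr => u _; case: (u \in _).
Qed.

(** The second moment counts common neighbours of pairs in [S]: a diagonal pair has [n], any other
    pair at most 2, and only at distance 2. *)
Lemma sum_deg2_le S : \sum_u #|S :&: nbr u| ^ 2 <=
  #|S| * n + 2 * \sum_(w in S) \sum_(x in S) dist2 w x.
Proof.
have -> : \sum_u #|S :&: nbr u| ^ 2 =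
    \sum_(w in S) \sum_(x in S) #|nbr w :&: nbr x|.
  under eq_bigr do rewrite -mulnn card_setIE big_distrlr.
  rewrite exchange_big; apply: eq_bigr => w _; rewrite exchange_big.
  apply: eq_bigr => x _; rewrite card_setIE [RHS]big_mkcond; apply: eq_bigr => u _.
  by rewrite /= !(nbr_sym u); case: (u \in nbr w); rewrite ?mul1n.
rewrite -sum_nat_const big_distrr -big_split; apply: leq_sum => w wS.
rewrite (bigD1 w wS) /= setIid card_nbr leq_add2l big_distrr.
rewrite [X in _ <= X](bigD1 w wS) /=; apply: leq_trans (leq_addl _ _).
by apply: leq_sum => x /andP[_ xw]; apply: card_common_nbr; rewrite eq_sym.
Qed.

(** The left side counts paths [x], [w], [y] in the distance-2 graph. The ends coincide, or are
    distinct and not at distance 2 (at most 16 middles), or close a triangle, which lies in some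
    [nbr u] and is charged to the cubes. *)
Lemma sum_dist2_sqr S :
  \sum_(w in S) (\sum_(x in S) dist2 w x) ^ 2 <=
  17 * #|S| ^ 2 + \sum_u #|S :&: nbr u| ^ 3.
Proof.
pose far w x y : bool := [&& x != y, ~~ dist2 x y, dist2 w x & dist2 w y].
pose tri w x y := \sum_u (u \in nbr w) * (u \in nbr x) * (u \in nbr y).
have pt w x y : dist2 w x * dist2 w y <= (x == y) + far w x y + tri w x y.
  rewrite /far; case: (boolP (dist2 w x)) => // wx; case: (boolP (dist2 w y)) => // wy.
  case: (x =P y) => // xy; case: (boolP (dist2 x y)) => // dxy /=.
  have [u [wu xu yu]] := dist2_triangle (eqP wx) (eqP wy) (eqP dxy).
  by rewrite /tri (bigD1 u) //= !(nbr_sym _ u) wu xu yu.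
have -> : \sum_(w in S) (\sum_(x in S) dist2 w x) ^ 2 =
    \sum_(w in S) \sum_(x in S) \sum_(y in S) dist2 w x * dist2 w y.
  apply: eq_bigr => w _; by rewrite -mulnn big_distrlr.
apply: (@leq_trans (\sum_(w in S) \sum_(x in S) \sum_(y in S)
    ((x == y) + far w x y + tri w x y))).
  by apply: leq_sum => w _; apply: leq_sum => x _; apply: leq_sum => y _.
have split3 : \sum_(w in S) \sum_(x in S) \sum_(y in S)
    ((x == y) + far w x y + tri w x y) =
  \sum_(w in S) \sum_(x in S) \sum_(y in S) (x == y) +
  \sum_(w in S) \sum_(x in S) \sum_(y in S) far w x y +
  \sum_(w in S) \sum_(x in S) \sum_(y in S) tri w x y.
  rewrite -!big_split; apply: eq_bigr => w _; rewrite -!big_split.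
  by apply: eq_bigr => x _; rewrite -!big_split.
rewrite split3 {split3 pt}; apply: leq_add; last first.
  rewrite eq_leq //; under eq_bigr => w _ do
    (under eq_bigr => x _ do rewrite exchange_big; rewrite exchange_big).
  rewrite exchange_big; apply: eq_bigr => u _.
  rewrite expnS -mulnn card_setIE big_distrlr big_distrl; apply: eq_bigr => w _.
  rewrite big_distrr; apply: eq_bigr => x _.
  rewrite !big_distrr; apply: eq_bigr => y _ /=.
  by rewrite !(nbr_sym u) mulnA.
rewrite (_ : 17 = 1 + 16) // mulnDl mul1n; apply: leq_add.
  rewrite expnS expn1 -sum_nat_const; apply: leq_sum => w _.
  rewrite -sum1_card; apply: leq_sum => x xS.
  by rewrite (bigD1 x xS) /= eqxx big1 // => y /andP[_]; rewrite eq_sym => /negbTE->.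
rewrite exchange_big; under eq_bigr do rewrite exchange_big.
rewrite mulnC -mulnn -mulnA -sum_nat_const; apply: leq_sum => x _.
rewrite -sum_nat_const; apply: leq_sum => y _.
case: (boolP ((x != y) && ~~ dist2 x y)) => [/andP[xy dxy]|nxy]; last first.
  by rewrite big1 // => w _; rewrite /far andbA (negbTE nxy).
apply: leq_trans (card_dist2_common _ dxy); last by rewrite diffs_eq0.
rewrite -sum1_card big_mkcond [X in _ <= X]big_mkcond; apply: leq_sum => w _.
by rewrite inE /far xy dxy /dist2; case: (w \in S) => //; case: (_ && _).
Qed.

(* Count paths of length two in the distance-2 graph on S: there are many by
   Cauchy-Schwarz, but pairs at distance 4 have boundedly many common distance-2
   neighbours, so most paths close up to triangles, and these lie in a common
   neighbourhood. *)
Lemma exists_large_degree S : 300 <= n -> #|S| = n ->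
  10 * #|nbrs S| <= 6 * n ^ 2 -> exists u, n <= 30 * #|S :&: nbr u|.
Proof.
(* Tangent form of Cauchy-Schwarz, sharp at k = 2a/5: the mean of [e] over [S] turns out to be at
   least 2n/5 ([P_ge]). *)
have CS1 a k : 20 * a * k <= 25 * k ^ 2 + 4 * a ^ 2.
  by have [] := nat_Cauchy (5 * k) (2 * a); rewrite -!mulnn; lia.
move=> n300 cS cU; apply/existsP; apply/contraT; rewrite negb_exists => /forallP small.
pose d u := #|S :&: nbr u|; pose e w := \sum_(x in S) dist2 w x.
have := sum_deg S; have := sum_deg2_le S; have := sum_dist2_sqr S.
rewrite -/(d _) cS => T_le X_le degE.
(* For [u] in [nbrs S] the degree d is at least 1, so (d - 1)(d - 2) >= 0, that is 3d <= d^2 + 2. *)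
have Xge : 3 * (n * n) <= \sum_u d u ^ 2 + 2 * #|nbrs S|.
  rewrite -degE big_distrr -sum1_card big_distrr [X in _ <= _ + X]big_mkcond.
  rewrite -big_split; apply: leq_sum => u _ /=.
  rewrite /d; case: (posnP #|S :&: nbr u|) => [->//|/[dup] d_gt0 /card_gt0P[w]].
  rewrite inE nbr_sym => /andP[wS uw].
  rewrite (_ : u \in _); last by apply/nbrsP; exists w.
  by case: #|_| d_gt0 => [|[|k]] // _; nia.
have P_le : \sum_(w in S) e w <= n * n.
  rewrite -[X in _ <= X * _]cS -sum_nat_const; apply: leq_sum => w _.
  by rewrite /e -[X in _ <= X]cS -sum1_card; apply: leq_sum => x _; case: dist2.
have CS : 20 * n * \sum_(w in S) e w <= 25 * \sum_(w in S) e w ^ 2 + 4 * n ^ 3.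
  have -> : 4 * n ^ 3 = \sum_(w in S) 4 * n ^ 2 by rewrite sum_nat_const cS; nia.
  rewrite !big_distrr -big_split; apply: leq_sum => w _ /=.
  exact: CS1.
have Y_le : 30 * \sum_u d u ^ 3 <= n * \sum_u d u ^ 2.
  rewrite !big_distrr; apply: leq_sum => u _ /=.
  by have := small u; rewrite -ltnNge -/(d u); nia.
move: T_le X_le Xge P_le CS Y_le cU.
rewrite -[\sum_(w in S) \sum_(x in S) _]/(\sum_(w in S) e w).
rewrite -[\sum_(w in S) (\sum_(x in S) _) ^ 2]/(\sum_(w in S) e w ^ 2).
rewrite -[\sum_u #|_| ^ 2]/(\sum_u d u ^ 2) -[\sum_u #|_| ^ 3]/(\sum_u d u ^ 3).
move: (\sum_u d u ^ 2) (\sum_u d u ^ 3) (\sum_(w in S) e w ^ 2) => X Y T.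
move: (\sum_(w in S) e w) => P T_le X_le Xge P_le CS Y_le cU.
have {cU Xge} P_ge : 8 * (n * n) <= 20 * P by lia.
have {X_le P_le} X_le : X <= 3 * (n * n) by lia.
(* Multiplying by [n] makes the rest linear in n^3. Together the bounds give 4n^3 <= 425n^2 +
   2.5n^3, which fails for n >= 300. *)
have nP : n * (8 * (n * n)) <= n * (20 * P) by rewrite leq_mul.
have nX : n * X <= n * (3 * (n * n)) by rewrite leq_mul.
have n3 : 300 * (n * n) <= n * (n * n) by rewrite leq_mul.
lia.
Qed.
End Cluster.

(** * Rigidity of generic colourings *)

Section Matched.
Variables (T : finType) (C : eqType) (c : T -> C).
Implicit Types (R Z U Y : {set T}).

Definition matched R Z : bool := [forall x in R, exists y in Z, c x == c y].

Lemma matchedP R Z :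
  reflect {in R, forall x, exists2 y, y \in Z & c x = c y} (matched R Z).
Proof.
apply: (iffP forall_inP) => m x xR; have := m x xR.
  by case/exists_inP => y yZ /eqP; exists y.
by case=> y yZ cxy; apply/exists_inP; exists y => //; apply/eqP.
Qed.

(** Keep one representative in [U] of each colour of [Y] that occurs on [U], at most [#|Y|] in all;
    [R] is the rest of [U]. *)
Lemma exists_matched_diff U Y : matched U Y ->
  exists R, [/\ R \subset U, matched R (U :\: R) & #|U| <= #|R| + #|Y|].
Proof.
move/matchedP => mUY.
(* The default is reached only when [y] itself is outside [U], so removing it from [U] changes
   nothing. *)
pose e y := odflt y [pick u in U | c u == c y].
have eP u y : u \in U -> c u = c y -> e y \in U /\ c (e y) = c y.
  move=> uU cuy; rewrite /e; case: pickP => [t /andP[tU /eqP]//|/(_ u)].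
  by rewrite uU cuy eqxx.
exists (U :\: e @: Y); split; first exact: subsetDl.
  apply/matchedP => x /setDP[xU _]; have [y yY cxy] := mUY x xU.
  have [eU ce] := eP _ _ xU cxy; exists (e y); last by rewrite ce.
  by rewrite !inE eU andbT negb_and negbK imset_f.
rewrite -[#|U|](cardsID (e @: Y)) addnC leq_add2l.
by apply: leq_trans (leq_imset_card e Y); rewrite subset_leq_card ?subsetIr.
Qed.
End Matched.

Section Generic.
Variables (n : nat) (C : eqType).
Local Notation V := {ffun 'I_n -> bool}.

(* nbrs (nbr v) contains v besides the vertices at distance 2. *)
Definition sphere (b : bool) (v : V) : {set V} :=
  if b then nbr v else nbrs (nbr v).

(* R and its complement in nbrs S record colour repetitions: if c takes few
   values on nbrs S, then removing one representative of each colour leaves a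
   large matched R. *)
Definition globally_generic (c : V -> C) : bool :=
  [forall S : {set V}, forall R : {set V},
    [&& #|S| == n, R \subset nbrs S & matched c R (nbrs S :\: R)] ==>
    (10 * #|R| < n ^ 2)].

Definition locally_generic (c : V -> C) : bool :=
  [forall u : V, forall v : V, forall b : bool, forall R : {set V},
    [&& R \subset nbr u, [disjoint R & sphere b v] & matched c R (sphere b v)] ==>
    (40 * #|R| < n)].
End Generic.

Section Rigidity.
Variables (n : nat) (C : eqType).
Local Notation V := {ffun 'I_n -> bool}.
Variables (c : V -> C) (f : V -> V) (psi : V -> V -> V).
Hypothesis n_ge : 400 <= n.
Hypothesis f_bij : bijective f.
Hypothesis psi_nbr : forall v x, x \in nbr v -> f (psi v x) \in nbr (f v).
Hypothesis psi_col : forall v x, x \in nbr v -> c (psi v x) = c x.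
Hypothesis psi_inj : forall v, {in nbr v &, injective (psi v)}.
Hypothesis c_global : globally_generic c.
Hypothesis c_local : locally_generic c.
Implicit Types (u v w x y : V).

Let nbrf v : {set V} := f @^-1: nbr (f v).

Let mem_nbrf v x : (x \in nbrf v) = (f x \in nbr (f v)).
Proof. by rewrite [LHS]inE. Qed.

Let card_nbrf v : #|nbrf v| = n.
Proof. by rewrite on_card_preimset ?card_nbr //; apply: onW_bij. Qed.

Let psi_onto v y : y \in nbrf v -> exists2 x, x \in nbr v & y = psi v x.
Proof.
suff /eqP <- : psi v @: nbr v == nbrf v by case/imsetP => x; exists x.
rewrite eqEcard card_nbrf card_in_imset ?card_nbr ?leqnn ?andbT; last exact: psi_inj.
by apply/subsetP => _ /imsetP[x xv ->]; rewrite inE psi_nbr.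
Qed.

Let local_bound b u v (R : {set V}) : R \subset nbr u ->
  [disjoint R & sphere b v] -> matched c R (sphere b v) -> 40 * #|R| < n.
Proof.
move=> Ru Rv m; have /forallP/(_ u)/forallP/(_ v)/forallP/(_ b)/forallP/(_ R) := c_local.
by rewrite Ru Rv m.
Qed.

Let exists_center v : exists u, n <= 30 * #|nbrf v :&: nbr u|.
Proof.
apply: exists_large_degree => //; first lia.
pose Y := f @^-1: nbrs (nbr (f v)).
have cY : 2 * #|Y| <= n ^ 2.
  by rewrite on_card_preimset ?card_nbrs_nbr //; [lia | apply: onW_bij].
have : matched c (nbrs (nbrf v)) Y.
  apply/matchedP => u /nbrsP[w wv uw]; exists (psi w u); last by rewrite psi_col.
  by rewrite inE; apply/nbrsP; exists (f w); [rewrite inE in wv | apply: psi_nbr].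
case/exists_matched_diff => R [RU mR leU].
have /forallP/(_ (nbrf v))/forallP/(_ R) := c_global.
rewrite card_nbrf eqxx RU mR => /implyP/(_ isT).
(* The factor 6/10 is 1/10 from [R] plus 1/2 from [Y]. *)
suff arith a b d m : d <= a + b -> 2 * b <= m -> 10 * a < m -> 10 * d <= 6 * m.
  exact: arith leU cY.
lia.
Qed.

Let center v : n <= 30 * #|nbrf v :&: nbr v|.
Proof.
have [u] := exists_center v; case: (eqVneq u v) => [->//|uv le_n].
(* Removing [nbr v] gives the disjointness required by genericity and costs at most two vertices.
   The gap between n/30 and n/40 absorbs this loss, as it does the loss of three in [nbrf_sub]. *)
pose R := (nbrf v :&: nbr u) :\: nbr v.
have : 40 * #|R| < n.
  apply: (local_bound (b := true) (u := u) (v := v)) => /=.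
  - by apply/subsetP => x /setDP[/setIP[]].
  - rewrite disjoint_sym disjoints_subset; apply/subsetP => x xv.
    by rewrite in_setC in_setD xv.
  apply/matchedP => x /setDP[/setIP[xv _] _].
  by have [y yv ->] := psi_onto xv; exists y; rewrite ?psi_col.
have : #|nbrf v :&: nbr u :&: nbr v| <= 2.
  have le2 : #|nbr u :&: nbr v| <= 2.
    by apply: leq_trans (card_common_nbr uv) _; case: (_ == 2).
  by apply: leq_trans le2; apply/subset_leq_card/setSI/subsetIr.
have := cardsID (nbr v) (nbrf v :&: nbr u); rewrite -/R; lia.
Qed.

Let nbrf_sub v w : w \in nbrf v -> w \in nbr v.
Proof.
move=> wv; apply/contraT => wNv; have [g fK gK] := f_bij.
have vw : v != w.
  by apply: contraTneq wv => ->; rewrite !inE /= cube_adj_irr.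
(* The fourth corner of the pulled-back 4-cycle through [x], [v], [w]: its image under [f] is the
   coordinatewise sum of [f x], [f v] and [f w] modulo 2. *)
pose opp x := g (flip (f x) (diffs (f v) (f w))).
have opp_v x : x \in nbrf v -> opp x \in nbrf w /\ opp x \in nbrf x.
  rewrite 3!mem_nbrf !mem_nbr gK diffs_flip => xv; move: wv.
  rewrite mem_nbrf mem_nbr => wv; split=> //.
  rewrite (_ : diffs _ _ = diffs (f v) (f x)) //.
  by apply/setP => i; rewrite !inE ffunE inE; case: (f v i) (f w i) (f x i) => [] [] [].
(* The corners themselves need not lie in [nbr w]; [Q] holds their equally coloured counterparts
   under [psi w], which do. *)
pose Q := [set x in nbr w | psi w x \in opp @: (nbrf v :&: nbr v)].
have opp_inj : injective opp.
  move=> x y /(can_inj gK) e; apply: (can_inj fK); apply/ffunP => i.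
  by move/ffunP/(_ i): e; rewrite !ffunE => /addIb.
have cQ : #|nbrf v :&: nbr v| <= #|Q|.
  rewrite -(card_imset _ opp_inj); apply: leq_trans (leq_imset_card (psi w) Q).
  apply/subset_leq_card/subsetP => y yI; have /imsetP[x /setIP[/opp_v[xw _] _] yx] := yI.
  have [z zw e] := psi_onto xw; apply/imsetP; exists z; last by rewrite yx.
  by rewrite inE zw -e -yx.
pose R := Q :\: nbrs (nbr v).
have : 40 * #|R| < n.
  apply: (local_bound (b := false) (u := w) (v := v)) => /=.
  - by apply/subsetP => x /setDP[]; rewrite inE => /andP[].
  - rewrite disjoint_sym disjoints_subset; apply/subsetP => x xv.
    by rewrite in_setC in_setD xv.
  apply/matchedP => x /setDP[]; rewrite inE => /andP[xw /imsetP[y /setIP[yvf yv] e]] _.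
  have [z zy e2] := psi_onto (proj2 (opp_v _ yvf)).
  exists z; first by apply/nbrsP; exists y.
  by rewrite -(psi_col xw) e e2 psi_col.
have : #|Q :&: nbrs (nbr v)| <= 3.
  apply: leq_trans (card_nbr_nbrs_nbr vw wNv); apply/subset_leq_card/setSI.
  by apply/subsetP => x; rewrite inE => /andP[].
have := cardsID (nbrs (nbr v)) Q; have := center v; rewrite -/R; lia.
Qed.

Lemma generic_rigid v w : cube_adj (f v) (f w) = cube_adj v w.
Proof.
have /setP/(_ w) : nbrf v = nbr v.
  apply/eqP; rewrite eqEcard card_nbrf card_nbr leqnn andbT.
  by apply/subsetP => x; apply: nbrf_sub.
by rewrite !inE.
Qed.
End Rigidity.

(** * Neighbourhood maps extracted from local equivalence *)

Section LocalEquivalence.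
Variable n : nat.
Hypothesis n_ge2 : 2 <= n.
Local Notation V := {ffun 'I_n -> bool}.

Lemma mem_ball1 (v w : hypercube n) :
  (w \in ball_set 1 v) = (w == v) || (w \in @nbr n v).
Proof.
rewrite !inE; apply/existsP/orP => [[k /existsP[p /andP[]]]|[/eqP->|vw]].
- case: k p => [[|[|//]] k_lt] /= p.
    by rewrite (tuple0 p) /= eq_sym => _ ->; left.
  by case/tupleP: p => x t; rewrite (tuple0 t) /= andbT => vx /eqP <-; right.
- by exists ord0; apply/existsP; exists [tuple]; rewrite /= eqxx.
- by exists ord_max; apply/existsP; exists [tuple w]; rewrite /= vw eqxx.
Qed.

(** The ball is a star with at least two leaves, so an isomorphism must preserve the centre:
    otherwise the image of [v] and another neighbour of [u] would be adjacent, making a triangle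
    with [u]. *)
Lemma local_equiv_star (chi lam : colouring (hypercube n)) (v u : hypercube n) :
  col_equiv (local_colouring 1 chi v) (local_colouring 1 lam u) ->
  exists phi : V -> V, [/\ phi v = u, {in nbr v &, injective phi},
    forall x, x \in nbr v -> phi x \in nbr u &
    forall x, x \in v |: nbr v -> chi x = lam (phi x)].
Proof.
case=> phi [[phi_bij phi_adj] phi_col].
have inv : v \in ball_set 1 v by rewrite mem_ball1 eqxx.
have inx x : x \in @nbr n v -> x \in ball_set 1 v by rewrite mem_ball1 => ->; rewrite orbT.
pose ctr : ball_graph 1 v := exist _ v inv.
have phi_ctr : val (phi ctr) = u.
  have := valP (phi ctr); rewrite mem_ball1 => /orP[/eqP//|uz].
  have [y yu yz] := exists_nbr_neq u (val (phi ctr)) n_ge2.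
  have yb : y \in ball_set 1 u by rewrite mem_ball1 yu orbT.
  have [psi _ psiK] := phi_bij.
  have [x phix] : exists x, val (phi x) = y.
    by exists (psi (exist _ y yb)); apply: (congr1 val (psiK _)).
  have /orP[/eqP xv|vx] : (val x == v) || (val x \in @nbr n v).
    by rewrite -mem_ball1 (valP x).
    have e : x = ctr by apply: val_inj.
    by move: yz; rewrite -phix e => /eqP.
  have := nbr_triangle_free uz yu; rewrite inE -phix.
  by have := phi_adj ctr x; rewrite /= => ->; rewrite inE in vx; rewrite vx.
pose ext x : V := if insub x is Some s then val (phi s) else x.
have extE (s : ball_graph 1 v) : ext (val s) = val (phi s) by rewrite /ext valK.
exists ext; split.
- by rewrite -[v]/(val ctr) extE.
- move=> x y xv yv; rewrite -[x]/(val (exist _ x (inx x xv) : ball_graph 1 v)).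
  rewrite -[y]/(val (exist _ y (inx y yv) : ball_graph 1 v)) !extE.
  by move/val_inj/(bij_inj phi_bij) => ->.
- move=> x xv; have : ext x \in @nbr n (val (phi ctr)); last by rewrite phi_ctr.
  rewrite -[x]/(val (exist _ x (inx x xv) : ball_graph 1 v)) extE inE.
  by have := phi_adj ctr (exist _ x (inx x xv)); rewrite /= => ->; rewrite inE in xv.
move=> x /setU1P xv; have xb : x \in ball_set 1 v.
  by rewrite mem_ball1; case: xv => [->|->]; rewrite ?eqxx ?orbT.
rewrite -[x]/(val (exist _ x xb : ball_graph 1 v)) extE.
exact: phi_col.
Qed.
End LocalEquivalence.

Lemma generic_distinguishable n (chi : colouring (hypercube n)) : 400 <= n ->
  globally_generic (chi : {ffun 'I_n -> bool} -> nat) ->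
  locally_generic (chi : {ffun 'I_n -> bool} -> nat) ->
  distinguishable 1 chi.
Proof.
move=> n_ge glob loc [lam [[f [f_bij f_loc]]]]; apply.
have n_ge2 : 2 <= n by lia.
have [phi phiP] := fin_all_exists (fun v => local_equiv_star n_ge2 (f_loc v)).
have [g fK gK] := f_bij.
have colE v : chi v = lam (f v).
  by have [<- _ _ ->] := phiP v; rewrite ?setU11.
exists f; split; last exact: colE.
(* Pulling [phi v] back along [f] turns a comparison of [chi] with [lam] into one between two
   neighbourhoods under [chi] alone. *)
split=> // x y; apply: (@generic_rigid n nat chi f (fun v w => g (phi v w))) => //.
- by move=> v w vw; rewrite gK; have [_ _ ->] := phiP v.
- by move=> v w vw; rewrite colE gK; have [_ _ _ ->] := phiP v; rewrite // setU1r.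
- by move=> v; have [_ inj _ _] := phiP v => w z wv zv /(can_inj gK); apply: inj.
Qed.

(** * Counting non-generic colourings *)

Section Counting.
Variables (T : finType) (q : nat).
Local Notation col := {ffun T -> 'I_q}.
Implicit Types (R Z : {set T}).

Let set_col (c : col) (x : T) (a : 'I_q) : col := [ffun y => if y == x then a else c y].

(** Recolour [x] arbitrarily, remembering a vertex of [Z] that shared its old colour. This vertex is
    not [x], so it keeps its colour and the old colouring can be recovered. *)
Lemma card_matched_step R Z x : x \in R -> [disjoint R & Z] ->
  #|[set c : col | matched c R Z]| * q <=
  #|Z| * #|[set c : col | matched c (R :\ x) Z]|.
Proof.
move=> xR RZ; have neqZ y : y \in Z -> (y == x) = false.
  by move=> yZ; apply: contraTF yZ => /eqP->; rewrite (disjointFr RZ).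
pose e (c : col) := odflt x [pick y in Z | c x == c y].
have eP (c : col) : matched c R Z -> e c \in Z /\ c x = c (e c).
  move/matchedP/(_ x xR) => [y yZ cxy]; rewrite /e.
  case: pickP => [t /andP[tZ /eqP]//|/(_ y)].
  by rewrite yZ cxy eqxx.
pose h (p : col * 'I_q) := (e p.1, set_col p.1 x p.2).
set E := [set c : col | matched c R Z].
have -> : #|E| * q = #|setX E [set: 'I_q]| by rewrite cardsX cardsT card_ord.
rewrite -cardsX -[X in X <= _](_ : #|h @: setX E [set: 'I_q]| = _); last first.
  apply: card_in_imset => -[c a] [c' a']; rewrite !inE /= !andbT => m m' [ee /ffunP ec].
  have [eZ cx] := eP c m; have [_ cx'] := eP c' m'.
  have := ec x; rewrite !ffunE eqxx => ->; congr pair; apply/ffunP => y.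
  case: (eqVneq y x) => [->|yx]; last by have := ec y; rewrite !ffunE (negbTE yx).
  by rewrite cx cx' -ee; have := ec (e c); rewrite !ffunE neqZ.
apply/subset_leq_card/subsetP => _ /imsetP[[c a] + ->].
case/setXP; rewrite inE => m _; have [eZ _] := eP c m; rewrite inE /= eZ inE.
apply/matchedP => y /setD1P[yx yR]; have /matchedP/(_ y yR)[z zZ cyz] := m.
by exists z; rewrite // !ffunE (negbTE yx) neqZ.
Qed.

(** The probability bound (|Z|/q)^|R| with denominators cleared, by removing the vertices of [R] one
    at a time. *)
Lemma card_matched R Z : [disjoint R & Z] ->
  #|[set c : col | matched c R Z]| * q ^ #|R| <= #|Z| ^ #|R| * q ^ #|T|.
Proof.
move: {2}#|R| (erefl #|R|) => k; elim: k R => [|k IH] R cR RZ.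
  rewrite cR !mul1n muln1 -[q in X in _ <= X]card_ord -card_ffun; exact: max_card.
have /card_gt0P[x xR] : 0 < #|R| by rewrite cR.
have cR' : #|R :\ x| = k by move: cR; rewrite (cardsD1 x) xR add1n => -[].
have RZ' : [disjoint R :\ x & Z] by apply: disjointWl RZ; apply: subsetDl.
rewrite cR !expnS mulnA; apply: leq_trans (leq_mul (card_matched_step xR RZ) (leqnn _)) _.
by rewrite -!mulnA leq_mul2l; have := IH _ cR' RZ'; rewrite cR' => ->; rewrite orbT.
Qed.

Lemma card_matched_le l m R Z : 0 < m -> 2 ^ l * m <= q ->
  [disjoint R & Z] -> #|Z| <= m ->
  #|[set c : col | matched c R Z]| * 2 ^ (l * #|R|) <= q ^ #|T|.
Proof.
have exp_le a b k : a <= b -> a ^ k <= b ^ k by case: k => // k; rewrite leq_exp2r.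
move=> m_gt0 q_ge RZ Zm; rewrite -(@leq_pmul2r (m ^ #|R|)) ?expn_gt0 ?m_gt0 //.
rewrite -mulnA expnM -expnMn.
apply: (@leq_trans (#|[set c : col | matched c R Z]| * q ^ #|R|)).
  by rewrite leq_mul2l exp_le ?orbT.
apply: leq_trans (card_matched RZ) _; rewrite mulnC leq_mul2l exp_le ?orbT //.
Qed.
End Counting.

Lemma card_bigcup_le (T I : finType) (P : pred I) (B : I -> {set T}) M k :
  (forall i, P i -> #|B i| * M <= k) -> #|\bigcup_(i | P i) B i| * M <= #|P| * k.
Proof.
move=> Bk; rewrite -[X in _ <= X]sum_nat_const.
elim/big_rec2: _ => [|i m A Pi le_m]; first by rewrite cards0.
apply: leq_trans (leq_add (Bk i Pi) le_m).
by rewrite -mulnDl leq_mul2r leq_card_setU orbT.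
Qed.

Section UnionBound.
Variables (n q : nat).
Local Notation V := {ffun 'I_n -> bool}.
Local Notation col := {ffun V -> 'I_q}.
Hypothesis n_gt0 : 0 < n.
Hypothesis q_ge : 2 ^ 200 * n ^ 2 <= q.

Lemma card_cube : #|{: V}| = 2 ^ n.
Proof. by rewrite card_ffun card_bool card_ord. Qed.

Lemma card_nsets : #|[pred S : {set V} | #|S| == n]| <= 2 ^ (n * n).
Proof.
have ffact_le m k : m ^_ k <= m ^ k.
  by elim: k => // k IH; rewrite ffactnSr expnSr leq_mul // leq_subr.
rewrite (_ : #|_| = 'C(#|V|, n)); last first.
  by rewrite -card_draws; apply: eq_card => S; rewrite !inE.
rewrite card_cube expnM; apply: leq_trans (_ : (2 ^ n) ^_ n <= _).
  by rewrite -bin_ffact leq_pmulr // fact_gt0.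
exact: ffact_le.
Qed.

(** Since |R| >= n^2/10, the factor 2^200 per vertex yields 2^(20n^2). The choices of [S] and of [R]
    inside [nbrs S] cost at most 2^(n^2) each. *)
Lemma card_not_globally_generic :
  #|[set c : col | ~~ globally_generic c]| * 2 ^ (18 * n ^ 2) <= q ^ (2 ^ n).
Proof.
pose big (S R : {set V}) := (R \subset nbrs S) && (n ^ 2 <= 10 * #|R|).
pose B (S : {set V}) : {set col} :=
  \bigcup_(R | big S R) [set c : col | matched c R (nbrs S :\: R)].
have cB (S : {set V}) : #|S| == n ->
    #|B S| * 2 ^ (20 * n ^ 2) <= 2 ^ (n * n) * q ^ (2 ^ n).
  move=> /eqP cS; apply: (@leq_trans (#|big S| * q ^ (2 ^ n))).
    apply: card_bigcup_le => R /andP[RS le_R].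
    apply: leq_trans (_ : #|[set c : col | matched c R (nbrs S :\: R)]| * 2 ^ (200 * #|R|) <= _).
      by rewrite leq_mul2l leq_exp2l // orbC; lia.
    rewrite -card_cube; apply: card_matched_le q_ge _ _; first by rewrite expn_gt0 n_gt0.
      by rewrite disjoint_sym disjoints_subset; apply/subsetP => x /setDP[_]; rewrite inE.
    apply: leq_trans (_ : #|nbrs S| <= _); first by rewrite subset_leq_card ?subsetDl.
    by apply: leq_trans (card_nbrs_le S) _; rewrite cS mulnn.
  rewrite leq_mul2r; apply/orP; right.
  apply: (@leq_trans #|powerset (nbrs S)|).
    by apply/subset_leq_card/subsetP => R; rewrite inE unfold_in => /andP[].
  by rewrite card_powerset leq_exp2l //; have := card_nbrs_le S; rewrite cS.
have := card_bigcup_le cB; set X := \bigcup_(S | _) _ => cX.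
apply: (@leq_trans (#|X| * 2 ^ (18 * n ^ 2))).
  rewrite leq_mul2r; apply/orP; right; apply/subset_leq_card/subsetP => c; rewrite inE.
  rewrite negb_forall => /existsP[S]; rewrite negb_forall => /existsP[R].
  rewrite negb_imply -leqNgt => /andP[/and3P[cS RS m] le_R].
  apply/bigcupP; exists S => //; apply/bigcupP; exists R; first by rewrite /big RS.
  by rewrite inE.
rewrite -(@leq_pmul2r (2 ^ (n * n + n * n))) ?expn_gt0 // -mulnA -expnD.
have -> : 18 * n ^ 2 + (n * n + n * n) = 20 * n ^ 2 by lia.
apply: leq_trans cX _; rewrite mulnA mulnC expnD leq_mul2l leq_mul2r.
by rewrite card_nsets !orbT.
Qed.

(** Here |R| >= n/40 yields 2^(5n), while [u], [v], [R] and [b] offer at most 2^(3n+1) <= 2^(4n)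
    choices. *)
Lemma card_not_locally_generic :
  #|[set c : col | ~~ locally_generic c]| * 2 ^ n <= q ^ (2 ^ n).
Proof.
pose big b (u v : V) (R : {set V}) :=
  [&& R \subset nbr u, [disjoint R & sphere b v] & n <= 40 * #|R|].
pose B1 (u v : V) b : {set col} :=
  \bigcup_(R | big b u v R) [set c : col | matched c R (sphere b v)].
pose B2 (u v : V) : {set col} := \bigcup_(b | predT b) B1 u v b.
pose B3 (u : V) : {set col} := \bigcup_(v | predT v) B2 u v.
have cB1 (u v : V) b : predT b -> #|B1 u v b| * 2 ^ (5 * n) <= 2 ^ n * q ^ (2 ^ n).
  move=> _; apply: (@leq_trans (#|big b u v| * q ^ (2 ^ n))).
    apply: card_bigcup_le => R /and3P[Ru Rv le_R].
    apply: leq_trans (_ : #|[set c : col | matched c R (sphere b v)]| * 2 ^ (200 * #|R|) <= _).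
      by rewrite leq_mul2l leq_exp2l // orbC; lia.
    rewrite -card_cube; apply: card_matched_le q_ge Rv _; first by rewrite expn_gt0 n_gt0.
    rewrite /sphere; case: (b); first by rewrite card_nbr; nia.
    by apply: leq_trans (card_nbrs_le _) _; rewrite card_nbr mulnn.
  rewrite leq_mul2r; apply/orP; right.
  apply: (@leq_trans #|powerset (nbr u)|); last by rewrite card_powerset card_nbr.
  by apply/subset_leq_card/subsetP => R; rewrite inE unfold_in => /andP[].
have cB2 (u v : V) : predT v -> #|B2 u v| * 2 ^ (5 * n) <= 2 * (2 ^ n * q ^ (2 ^ n)).
  by move=> _; have := card_bigcup_le (cB1 u v); rewrite card_bool.
have cB3 (u : V) : predT u ->
    #|B3 u| * 2 ^ (5 * n) <= 2 ^ n * (2 * (2 ^ n * q ^ (2 ^ n))).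
  by move=> _; have := card_bigcup_le (cB2 u); rewrite card_cube.
have := card_bigcup_le cB3; rewrite card_cube; set X := \bigcup_(u | _) _ => cX.
apply: (@leq_trans (#|X| * 2 ^ n)).
  rewrite leq_mul2r; apply/orP; right; apply/subset_leq_card/subsetP => c; rewrite inE.
  rewrite negb_forall => /existsP[u]; rewrite negb_forall => /existsP[v].
  rewrite negb_forall => /existsP[b]; rewrite negb_forall => /existsP[R].
  rewrite negb_imply -leqNgt => /andP[/and3P[Ru Rv m] le_R].
  apply/bigcupP; exists u => //; apply/bigcupP; exists v => //.
  apply/bigcupP; exists b => //; apply/bigcupP; exists R; last by rewrite inE.
  by rewrite /big Ru Rv.
rewrite -(@leq_pmul2r (2 ^ (4 * n))) ?expn_gt0 // -mulnA -expnD.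
have -> : n + 4 * n = 5 * n by lia.
apply: leq_trans cX _; rewrite !mulnA mulnC leq_mul2l; apply/orP; right.
by rewrite -[X in _ * X * _]expn1 -!expnD leq_exp2l //; lia.
Qed.

(** In probabilities: a uniform colouring is generic with probability at least 1 - 2/2^n. *)
Lemma card_generic_ge :
  q ^ (2 ^ n) * 2 ^ n <=
  #|[set c : col | globally_generic c && locally_generic c]| * 2 ^ n + 2 * q ^ (2 ^ n).
Proof.
rewrite -{1}card_cube -{1}[q]card_ord -card_ffun -cardsT.
pose G1 := [set c : col | ~~ globally_generic c].
pose G2 := [set c : col | ~~ locally_generic c].
set G := [set c : col | _].
have : #|[set: col]| <= #|G| + (#|G1| + #|G2|).
  apply: leq_trans (leq_add (leqnn _) (leq_card_setU G1 G2)).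
  apply: leq_trans (leq_card_setU _ _); apply/subset_leq_card/subsetP => c _.
  by rewrite !inE; case: globally_generic; case: locally_generic.
have := card_not_locally_generic; have := card_not_globally_generic; rewrite -/G1 -/G2.
have : #|G1| * 2 ^ n <= #|G1| * 2 ^ (18 * n ^ 2).
  by rewrite leq_mul2l leq_exp2l //; apply/orP; right; rewrite -mulnn; nia.
suff arith g g1 g2 t a b k : g1 * b <= g1 * a -> g1 * a <= k -> g2 * b <= k ->
  t <= g + (g1 + g2) -> t * b <= g * b + 2 * k by exact: arith.
move=> le1 le2 le3 /leq_mul/(_ (leqnn b)) le4; lia.
Qed.
End UnionBound.

(** * Random colourings *)

From mathcomp Require Import all_classical all_reals all_analysis.

Import Order.TTheory GRing.Theory Num.Theory.
Import numFieldNormedType.Exports.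

Local Open Scope classical_set_scope.
Local Open Scope ring_scope.

Section RandomColouring.
Variables (R : realType) (d : measure_display) (T : measurableType d).
Variables (P : probability T R) (n q : nat).
Variable chi : hypercube n -> {RV P >-> nat}.
Hypothesis chi_rand : random_colouring q chi.
Local Notation V := {ffun 'I_n -> bool}.

(** Written as an intersection over the full vertex set so that mutual independence applies
    directly. *)
Let fibre (h : V -> nat) : set T :=
  \bigcap_(v in [set` [set: hypercube n]%SET]) (chi v @^-1` [set h v]).

Let fibreP h w : fibre h w <-> forall v, chi v w = h v.
Proof. by split=> [hw v|hw v _]; [apply: hw; rewrite /= finset.in_setT|exact: hw]. Qed.

Let measurable_fibre h : measurable (fibre h).
Proof.
apply: fin_bigcap_measurable => [|v _]; first exact: finite_finset.
by rewrite -[X in measurable X]setTI; apply: measurable_funPT.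
Qed.

(** The successor shifts the values 0, ..., q - 1 of ['I_q] to the palette 1, ..., q. *)
Let fibre_prob (c : {ffun V -> 'I_q}) :
  P (fibre (fun v => (c v).+1)) = ((q ^ (2 ^ n))%:R^-1)%:E.
Proof.
have [unif indep] := chi_rand.
rewrite /fibre (indep [set: hypercube n]%SET (fun v => [set (c v).+1])) //.
rewrite (eq_bigr (fun=> (q%:R^-1 : R)%:E)); last first.
  by move=> v _; have := unif v (c v).+1; rewrite ltn_ord.
by rewrite prodEFin prodr_const cardsT card_cube natrX exprVn.
Qed.

(** There are only countably many maps from [V] to [nat], so every event determined by the colouring
    is a countable union of fibres. *)
Lemma measurable_colouring_pred (D : set (V -> nat)) :
  measurable [set w | D (fun v => chi v w)].
Proof.
pose F (h : {ffun V -> nat}) := if `[< D h >] then fibre h else set0.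
have -> : [set w | D (fun v => chi v w)] = \bigcup_h F h.
  apply/seteqP; split=> w /= => [Dw|[h _]].
    exists [ffun v => chi v w] => //; rewrite /F.
    have e : (fun v => chi v w) = [ffun v => chi v w] :> (V -> nat).
      by apply/funext => v; rewrite ffunE.
    by rewrite asboolT -?e //; apply/fibreP => v; rewrite ffunE.
  rewrite /F; case: asboolP => // Dh /fibreP hw.
  by rewrite (_ : (fun v => _) = h) //; apply/funext.
apply: countable_bigcupT_measurable; first exact: countableP.
by move=> h; rewrite /F; case: ifP.
Qed.

Lemma prob_colouring_ge (A : {set {ffun V -> 'I_q}}) (D : set (V -> nat)) :
  (forall c, c \in A -> D (fun v => (c v).+1)) ->
  ((#|A|%:R / (q ^ (2 ^ n))%:R)%:E <= P [set w | D (fun v => chi v w)])%E.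
Proof.
move=> AD; pose F (c : {ffun V -> 'I_q}) := fibre (fun v => (c v).+1).
have -> : (#|A|%:R / (q ^ (2 ^ n))%:R)%:E = P (\bigcup_(c in [set` A]) F c).
  rewrite measure_fin_bigcup //.
  - rewrite -(bigfs _ (r := index_enum _)) ?index_enum_uniq //; last first.
      by move=> c _; rewrite mem_index_enum.
    rewrite (eq_bigr (fun=> ((q ^ (2 ^ n))%:R^-1 : R)%:E)); last first.
      by move=> c _; exact: fibre_prob.
    by rewrite sumEFin sumr_const mulr_natl.
  - move=> c c' _ _ [w [/fibreP cw /fibreP cw']]; apply/ffunP => v.
    by apply/val_inj; have := cw v; rewrite cw' => -[].
  - by move=> c _; exact: measurable_fibre.
rewrite le_measure ?inE //.
- by apply: fin_bigcup_measurable => [|c _]; [exact: finite_finset|exact: measurable_fibre].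
- exact: measurable_colouring_pred.
move=> w [c /= cA /fibreP cw] /=.
by rewrite (_ : (fun v => _) = (fun v => (c v).+1)); [exact: AD|apply/funext].
Qed.
End RandomColouring.

(** The extra factor n^(log^(-1/2) n) equals exp(sqrt(log n)), which tends to infinity and so
    exceeds any constant 2^l. *)
Lemma near_le_powR (R : realType) (l : nat) :
  \forall n \near \oo, 2 ^+ l * n%:R ^+ 2 <=
    n%:R `^ (2 + (ln n%:R) `^ (- 2^-1)) :> R.
Proof.
near=> n.
(* This threshold gives sqrt(log n) >= l, and then 2^l <= e^l suffices. *)
have n_ge : expR (l%:R ^+ 2) <= n%:R :> R by near: n; exact: nbhs_infty_ger.
have n_gt0 : 0 < n%:R :> R by apply: lt_le_trans n_ge; exact: expR_gt0.
have ln_ge : l%:R ^+ 2 <= ln n%:R :> R by rewrite -ler_expR lnK ?posrE.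
have ln_ge0 : 0 <= ln n%:R :> R by apply: le_trans ln_ge; exact: sqr_ge0.
rewrite powRD; last by apply/implyP => _; rewrite gt_eqF.
rewrite powR_mulrn ?ler0n // [leLHS]mulrC ler_pM2l ?exprn_gt0 //.
have -> : n%:R `^ (ln n%:R `^ (- 2^-1)) = expR (Num.sqrt (ln n%:R)) :> R.
  rewrite {1}/powR gt_eqF // powRN powR12_sqrt //; congr expR.
  rewrite -[X in _ * X](sqr_sqrtr ln_ge0) expr2.
  have [->|s_neq0] := eqVneq (Num.sqrt (ln n%:R) : R) 0; first by rewrite !mulr0.
  by rewrite mulKf.
apply: (@le_trans _ _ (expR l%:R)).
  rewrite -[l%:R]mulr1 expRM_natl; apply: lerXn2r; rewrite ?nnegrE ?expR_ge0 //.
  exact: (expR_ge1Dx 1).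
by rewrite ler_expR -[l%:R]ger0_norm // -sqrtr_sqr ler_sqrt.
Unshelve. all: end_near. Qed.

Theorem theorem1p6 (R : realType) :
  exists K : R, 0 < K /\
    forall (q : nat -> nat)
      (d : nat -> measure_display) (T : forall n, measurableType (d n))
      (P : forall n, probability (T n) R)
      (chi : forall n, hypercube n -> {RV (P n) >-> nat}),
      (forall n, (0 < q n)%N) ->
      (forall n, (2 <= n)%N ->
        n%:R `^ (2 + K * (ln n%:R) `^ (- 2^-1)) <= (q n)%:R :> R) ->
      (forall n, random_colouring (q n) (chi n)) ->
      (fun n => P n [set w | distinguishable 1 (fun v => chi n v w)])
        @ \oo --> 1%E.
Proof.
(* K = 1 suffices because exp(sqrt(log n)) eventually exceeds the constant 2^200 of the union
   bounds. *)
exists 1; split=> // q d T P chi q_gt0 q_ge chi_rand.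
pose lo n : R := 1 - 2 * (2^-1) ^+ n.
apply: (@squeeze_cvge _ _ _ _ (fun n => (lo n)%:E) _ (fun=> 1%E)).
- near=> n; have n_ge : (400 <= n)%N by near: n; exact: nbhs_infty_ge.
  rewrite probability_le1 ?andbT; last first.
    exact: (measurable_colouring_pred (@chi n) (@distinguishable (hypercube n) 1)).
  pose A := [set c : {ffun {ffun 'I_n -> bool} -> 'I_(q n)} |
    globally_generic c && locally_generic c]%SET.
  have AD c : c \in A -> @distinguishable (hypercube n) 1 (fun v => (c v).+1).
    (* Genericity of c is by conversion that of its shift to {1, ..., q}. *)
    by rewrite inE => /andP[glob loc]; apply: generic_distinguishable.
  apply: le_trans (@prob_colouring_ge _ _ _ _ _ _ (@chi n) (chi_rand n) A
    (@distinguishable (hypercube n) 1) AD).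
  rewrite lee_fin /lo ler_pdivlMr ?ltr0n ?expn_gt0 ?q_gt0 //.
  have q_large : (2 ^ 200 * n ^ 2 <= q n)%N.
    rewrite -(ler_nat R) natrM !natrX; apply: le_trans (q_ge n _); last by lia.
    by rewrite mul1r; near: n; exact: near_le_powR.
  have := card_generic_ge (ltn_trans _ n_ge) q_large.
  move=> /(_ isT); rewrite -/A -(ler_nat R) natrD !natrM !natrX.
  move: (q n)%:R => qn le_A.
  have M_gt0 : 0 < 2 ^+ n :> R by rewrite exprn_gt0.
  rewrite -(ler_pM2r M_gt0) exprVn mulrAC mulrBl mul1r mulfVK ?gt_eqF //.
  by rewrite mulrBl [_ ^+ n * _]mulrC lerBlDr.
- apply: cvg_EFin; first by apply: nearW.
  rewrite -[X in _ --> X]subr0 -(mulr0 2); apply: cvgB; first exact: cvg_cst.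
  by apply: cvgZr; apply: cvg_expr; rewrite ger0_norm ?invf_lt1 ?ltr1n.
- exact: cvg_cst.
Unshelve. all: end_near. Qed.
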